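(* Let $C\subset\mathbb{P}^2$ be an algebraic plane curve of degree $d$ that is parameterizable by $(F_1,F_2)$, where $F_1,F_2$ are homogeneous forms of degree $d'$. Suppose that $C$ is also parameterizable by $(F^0_1,F^0_2)$, where $F_1^0,F_2^0$ are homogeneous forms of degree $d_0'$, and that both $d'<d$ and $d_0'<d$. Then either $d'+d_0'\geq d$, or $d'=d_0'$ and $\langle F_1,F_2\rangle=\langle F^0_1,F^0_2\rangle$ as ideals of $\mathbb{K}[X_1,X_2,X_3]$.
   Context: $\mathbb{K}$ is an algebraically closed field and $\mathbb{P}^k$ is projective $k$-space over $\mathbb{K}$. A plane curve $C\subset\mathbb{P}^2$ of degree $d$ is the zero locus of an irreducible homogeneous polynomial of degree $d$ in $\mathbb{K}[X_1,X_2,X_3]$. Given homogeneous polynomials $F_1,F_2\in\mathbb{K}[X_1,X_2,X_3]$ of the same degree and without common factors, $C$ is said to be parameterizable by $(F_1,F_2)$ if the rational map $\psi:C\dashrightarrow\mathbb{P}^1$, $(x_1:x_2:x_3)\mapsto(F_1(x):F_2(x))$, is birational with inverse a map $\phi:\mathbb{P}^1\to C$, $(t_1:t_2)\mapsto (u_1(t):u_2(t):u_3(t))$, given by homogeneous polynomials $u_1,u_2,u_3\in\mathbb{K}[T_1,T_2]$ of the same degree without common factors. *)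

(* Defs.v *)
From HB Require Import structures.
From mathcomp Require Import all_boot all_order all_algebra.
From mathcomp Require Import mpoly.

Set Implicit Arguments.
Unset Strict Implicit.
Unset Printing Implicit Defensive.

Import GRing.Theory.
Local Open Scope ring_scope.

Definition mpoly_dvd (K : fieldType) (n : nat) (g p : {mpoly K[n]}) : Prop :=
  exists q : {mpoly K[n]}, p = q * g.

Definition irreducible_mpoly (K : fieldType) (n : nat) (p : {mpoly K[n]}) : Prop :=
  [/\ p != 0, p \isn't a GRing.unit &
      forall a b : {mpoly K[n]},
        p = a * b -> a \is a GRing.unit \/ b \is a GRing.unit].

Definition no_common_factor (K : fieldType) (n m : nat)
    (F : m.-tuple {mpoly K[n]}) : Prop :=
  forall g : {mpoly K[n]},
    (forall i, mpoly_dvd g (tnth F i)) -> g \is a GRing.unit.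

Definition forms (K : fieldType) (n m e : nat)
    (F : m.-tuple {mpoly K[n]}) : Prop :=
  forall i, tnth F i \is e.-homog.

(* A point of P^(n-1) is given by a nonzero row of homogeneous coordinates,
   and two such rows give the same point when they are [proj_eq].  A subset of
   P^(n-1) is a predicate on rows that holds only at nonzero ones. *)
Definition proj_space (K : fieldType) (n : nat) (x : 'rV[K]_n) : Prop := x != 0.

Definition proj_eq (K : fieldType) (n : nat) (x y : 'rV[K]_n) : Prop :=
  exists2 c : K, c != 0 & y = c *: x.

Definition eval_forms (K : fieldType) (n m : nat)
    (F : m.-tuple {mpoly K[n]}) (x : 'rV[K]_n) : 'rV[K]_m :=
  \row_i (tnth F i).@[x 0].

Definition plane_curve (K : fieldType) (d : nat) (C : 'rV[K]_3 -> Prop) : Prop :=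
  exists f : {mpoly K[3]},
    [/\ irreducible_mpoly f, f \is d.-homog &
        forall x, C x <-> proj_space x /\ f.@[x 0] = 0].

(* [P] holds on some nonempty basic open subset [G != 0] of [X].  When [X] is
   irreducible, as it is below, every nonempty Zariski open subset is dense and
   contains a nonempty basic one. *)
Definition generically (K : fieldType) (n : nat)
    (X P : 'rV[K]_n -> Prop) : Prop :=
  exists (e : nat) (G : {mpoly K[n]}),
    [/\ G \is e.-homog, exists2 x, X x & G.@[x 0] != 0 &
        forall x, X x -> G.@[x 0] != 0 -> P x].

(* [F] defines a rational map from [X] to [Y], [U] is defined at its generic
   value, and the composite is the identity of [X] as a rational map. *)
Definition rational_section (K : fieldType) (n m : nat)
    (X : 'rV[K]_n -> Prop) (Y : 'rV[K]_m -> Prop)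
    (F : m.-tuple {mpoly K[n]}) (U : n.-tuple {mpoly K[m]}) : Prop :=
  generically X
    (fun x => Y (eval_forms F x) /\ proj_eq x (eval_forms U (eval_forms F x))).

Definition birational_inverse (K : fieldType) (n m : nat)
    (X : 'rV[K]_n -> Prop) (Y : 'rV[K]_m -> Prop)
    (F : m.-tuple {mpoly K[n]}) (U : n.-tuple {mpoly K[m]}) : Prop :=
  rational_section X Y F U /\ rational_section Y X U F.

Definition parameterizable (K : fieldType) (C : 'rV[K]_3 -> Prop) (e : nat)
    (F1 F2 : {mpoly K[3]}) : Prop :=
  [/\ forms e [tuple F1; F2],
      no_common_factor [tuple F1; F2] &
      exists (k : nat) (u : 3.-tuple {mpoly K[2]}),
        [/\ forms k u, no_common_factor u,
            (forall t, proj_space t -> C (eval_forms u t)) &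
            birational_inverse C (@proj_space K 2) [tuple F1; F2] u]].

Definition ideal2 (K : fieldType) (n : nat) (F1 F2 p : {mpoly K[n]}) : Prop :=
  exists a b : {mpoly K[n]}, p = a * F1 + b * F2.

(* Main.v *)
Require Import Defs.
From Stdlib Require Import Classical.
From HB Require Import structures.
From mathcomp Require Import all_boot all_order all_algebra.
From mathcomp Require Import mpoly.
From mathcomp Require Import zify ring.

Set Implicit Arguments.
Unset Strict Implicit.
Unset Printing Implicit Defensive.

Import GRing.Theory.
Local Open Scope ring_scope.

(* Let [u] parameterize [C = V(f)] with inverse [F], and let [F0] be the other
   pair.  The self-map [F0 o u] of the projective line has a rational
   retraction, so it is a projectivity: some invertible matrix sends [F0] to a
   pair [(A, B)] whose ratio agrees with that of [F] on [C].  Hence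
   [A F1 - B F2] is a form of degree [d' + d0'] that vanishes on [C], that is, a
   multiple of [f].  When [d' + d0' < d] it is zero, and unique factorization
   makes the coprime pairs [(A, B)] and [(F2, F1)] proportional. *)

(** * Unique factorization in polynomial rings *)

(** Unique factorization is needed twice: at the end, and to turn the irreducible [f] into a prime
    element, which gives both the irreducibility of [C] and the Nullstellensatz for [f].

    The obstacle is the projectivity. The retraction identity holds only up to a scalar and off the
    zeros of a form, and the components of [F0 o u] may share a factor [g]. On an affine chart,
    write the self-map as [g] times a coprime pair [(p, q)]. Since the field is closed, both
    components of the retraction split into linear forms; they have equal degree, so they carry the
    same power of [g], and it cancels. What remains is one equation between products of linear forms
    in [p] and [q], with an extra [X] on one side. It forces [X] and [1] to be combinations of [p]
    and [q], with no appeal to function fields or to the degree of a map.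

    The pair [(A, B)] meets [(F2, F1)] in reversed order because equality of the ratios of
    [(t0, t1)] and [(s0, s1)] is written as a product relation. *)

Definition rdvd (R : idomainType) (a b : R) : Prop := exists q, b = q * a.

Definition prime_elt (R : idomainType) (p : R) : Prop :=
  [/\ p != 0, p \isn't a GRing.unit &
      forall a b, rdvd p (a * b) -> rdvd p a \/ rdvd p b].

(** Inductive, so that facts about a product are proved by removing one prime factor at a time, down
    to a unit. *)
Inductive prime_product (R : idomainType) : R -> Prop :=
| prime_product_unit u : u \is a GRing.unit -> prime_product u
| prime_product_mul p c : prime_elt p -> prime_product c -> prime_product (p *
  c).

(* Kaplansky's characterization of unique factorization domains. *)
Definition factorial_ring (R : idomainType) : Prop :=
  forall c : R, c != 0 -> prime_product c.

(** * Primes and coprime pairs in a domain *)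

Section Divisibility.
Variable R : idomainType.
Implicit Types a b c d p : R.

Lemma unit_neq0 a : a \is a GRing.unit -> a != 0.
Proof. by apply: contraTneq => ->; rewrite unitr0. Qed.

Lemma rdvdM a b c : rdvd a b -> rdvd a (c * b).
Proof. by case=> q ->; exists (c * q); rewrite mulrA. Qed.

Lemma rdvdD a b c : rdvd a b -> rdvd a c -> rdvd a (b + c).
Proof. by case=> q -> [r ->]; exists (q + r); rewrite mulrDl. Qed.

Lemma rdvdB a b c : rdvd a b -> rdvd a c -> rdvd a (b - c).
Proof. by case=> q -> [r ->]; exists (q - r); rewrite mulrBl. Qed.

Lemma rdvd_trans b a c : rdvd a b -> rdvd b c -> rdvd a c.
Proof. by move=> ab [r ->]; apply: rdvdM. Qed.

Lemma rdvd_unit a b : rdvd a b -> b \is a GRing.unit -> a \is a GRing.unit.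
Proof. by case=> q ->; rewrite unitrM => /andP[]. Qed.

Lemma prime_productM a b :
  prime_product a -> prime_product b -> prime_product (a * b).
Proof.
move=> pa pb; elim: pa => [u uU|p c pp _ IH]; last first.
  by rewrite -mulrA; apply: prime_product_mul.
elim: pb => [v vU|p c pp _ IH].
  by apply: prime_product_unit; rewrite unitrM uU.
by rewrite mulrCA; apply: prime_product_mul.
Qed.

(** Split off one prime factor of [c]: by irreducibility the cofactor is a unit, so [c] is an
    associate of that prime. *)
Lemma irreducible_prime c : factorial_ring R -> c != 0 ->
    c \isn't a GRing.unit ->
    (forall a b, c = a * b -> a \is a GRing.unit \/ b \is a GRing.unit) ->
  prime_elt c.
Proof.
move=> ufd c0 cU irr; have pc := ufd _ c0.
case: pc c0 cU irr => [u -> //|p d pp _ _ _ irr].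
case: (irr _ _ erefl) => [pU|dU]; first by case: pp; rewrite pU.
case: pp => p0 pU pP; split; rewrite ?mulf_neq0 ?unitrM ?dU ?andbT ?(unit_neq0
  dU) //.
move=> a b [q e].
have assoc x : rdvd p x -> rdvd (p * d) x.
  by case=> r ->; exists (r * d^-1); rewrite [p * d]mulrC mulrA divrK.
case: (pP a b) => [|/assoc|/assoc]; [|by left|by right].
by exists (q * d); rewrite e mulrA [in RHS]mulrAC.
Qed.

(** A prime factor of [a] divides [b * x] but, by coprimality, not [b]; so it divides [x] and
    cancels. *)
Lemma coprime_dvd a b x y : prime_product a ->
    (forall g, rdvd g a -> rdvd g b -> g \is a GRing.unit) ->
  a * y = b * x -> rdvd a x.
Proof.
move=> pa; elim: pa x => {a} [u uU|p a [p0 pU pP] _ IH] x cop e.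
  by exists (x / u); rewrite divrK.
have [||[x' ex]] := pP b x.
- by rewrite -e; exists (a * y); rewrite -mulrA mulrC.
- move=> pb; case/negP: pU; apply: cop pb.
  by exists a; rewrite mulrC.
- case: (IH x').
  + by move=> g ga gb; apply: cop gb; apply: rdvdM.
  + by apply: (mulfI p0); rewrite mulrA e ex [LHS]mulrA [RHS]mulrC.
  by move=> w ew; exists w; rewrite ex ew -mulrA [a * p]mulrC.
Qed.

Lemma coprime_proportional a b x y : factorial_ring R ->
    (forall g, rdvd g a -> rdvd g b -> g \is a GRing.unit) ->
    (forall g, rdvd g x -> rdvd g y -> g \is a GRing.unit) ->
    a * y = b * x ->
  exists c, [/\ c \is a GRing.unit, x = c * a & y = c * b].
Proof.
move=> ufd.
wlog a0 : a b x y / a != 0 => [hw|] cab cxy e.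
  (* If [a] and [b] were both 0, then 0 would be a common divisor and hence a unit. So when [a] is 0
     the pairs can be swapped. *)
  have [a0|] := eqVneq a 0; last by move/hw; apply.
  have [b0|b0] := eqVneq b 0.
    have d0 : rdvd (0 : R) 0 by exists 0; rewrite mulr0.
    by have := cab 0; rewrite a0 b0 unitr0 => /(_ d0 d0).
  case: (hw b a y x b0) => [g gb ga|g gy gx|//|c [cU -> ->]].
  - exact: cab.
  - exact: cxy.
  by exists c.
have [c ex] := coprime_dvd (ufd _ a0) cab e.
have ey : y = c * b.
  by apply: (mulfI a0); rewrite e ex mulrCA [b * a]mulrC mulrCA.
exists c; split=> //; apply: cxy; [exists a|exists b]; by rewrite 1?mulrC.
Qed.

End Divisibility.

(** * Gauss's theorem: polynomials over a factorial ring *)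

Section PolyFactorial.
Variable R : idomainType.
Implicit Types (a c p : R) (f g h q : {poly R}).

Lemma rdvd_polyC a f : (forall i, rdvd a f`_i) -> rdvd a%:P f.
Proof.
elim/poly_ind: f => [|f c IH] af; first by exists 0; rewrite mul0r.
case: IH => [i|q ->].
  by have := af i.+1; rewrite coefD coefMX coefC addr0.
case: (af 0%N) => r; rewrite coefD coefMX coefC add0r => ->.
by exists (q * 'X + r%:P); rewrite polyCM mulrDl mulrAC.
Qed.

Lemma rdvd_polyC_coef a f i : rdvd a%:P f -> rdvd a f`_i.
Proof. by case=> q ->; exists q`_i; rewrite coefMC. Qed.

Lemma rdvd_polyCX a f : rdvd a%:P (f * 'X) -> rdvd a%:P f.
Proof.
move=> af; apply: rdvd_polyC => i.
by have := rdvd_polyC_coef i.+1 af; rewrite coefMX.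
Qed.

(** The product of the constant terms is divisible by [p], hence so is one of them. Subtracting its
    contribution leaves a multiple of ['X], and induction applies after division by ['X]. *)
Lemma prime_polyC p : prime_elt p -> prime_elt p%:P.
Proof.
case=> p0 pU pP; split; rewrite ?polyC_eq0 //.
  by rewrite poly_unitE coefC eqxx (negPf pU) andbF.
elim/poly_ind=> [|f a IHf]; first by left; exists 0; rewrite mul0r.
elim/poly_ind=> [|g b IHg]; first by right; exists 0; rewrite mul0r.
move=> pfg.
have polyCdvd (x : R) : rdvd p x -> rdvd p%:P x%:P.
  by case=> q ->; exists q%:P; rewrite polyCM.
have /pP[/polyCdvd pa|/polyCdvd pb] : rdvd p (a * b).
  have := rdvd_polyC_coef 0 pfg.
  by rewrite coef0M !coefD !coefMX !coefC !add0r.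
- have /rdvd_polyCX : rdvd p%:P (f * (g * 'X + b%:P) * 'X).
    have -> : f * (g * 'X + b%:P) * 'X =
      (f * 'X + a%:P) * (g * 'X + b%:P) - (g * 'X + b%:P) * a%:P.
      by rewrite mulrDl [a%:P * _]mulrC addrK mulrAC.
    by apply: rdvdB => //; apply: rdvdM.
  case/IHf=> [pf|]; [left|by right].
  by apply: rdvdD => //; rewrite mulrC; apply: rdvdM.
- have /rdvd_polyCX : rdvd p%:P ((f * 'X + a%:P) * g * 'X).
    have -> : (f * 'X + a%:P) * g * 'X =
      (f * 'X + a%:P) * (g * 'X + b%:P) - (f * 'X + a%:P) * b%:P.
      by rewrite mulrDr addrK mulrA.
    by apply: rdvdB => //; apply: rdvdM.
  case/IHg=> [|pg]; [by left|right].
  by apply: rdvdD => //; rewrite mulrC; apply: rdvdM.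
Qed.

Lemma prime_product_polyC c : prime_product c -> prime_product c%:P.
Proof.
elim=> [u uU|p d pp _ IH].
  by apply: prime_product_unit; rewrite poly_unitE size_polyC coefC eqxx uU
    unit_neq0.
by rewrite polyCM; apply: prime_product_mul => //; apply: prime_polyC.
Qed.

Definition primitive f : Prop := forall a, rdvd a%:P f -> a \is a GRing.unit.

Lemma primitive_dvd f g : rdvd g f -> primitive f -> primitive g.
Proof. by move=> gf pf a ag; apply: pf; apply: rdvd_trans gf. Qed.

(** Each prime factor of [c] stays prime as a constant polynomial; it cannot divide the primitive
    [f], so it divides [q] and cancels. *)
Lemma primitive_dvd_cancel c f g q : prime_product c -> primitive f ->
  c%:P * g = q * f -> rdvd f g.
Proof.
move=> pc pf; elim: pc q => {c} [u uU|p c pp _ IH] q e.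
  exists (u^-1%:P * q); rewrite -mulrA -e mulrA -polyCM mulVr //.
  by rewrite mul1r.
have [p0 pU _] := pp; have [_ _] := prime_polyC pp.
case/(_ q f) => [|[q' eq]|/pf].
- by rewrite -e; exists (c%:P * g); rewrite polyCM -mulrA mulrC.
- apply: (IH q'); apply: (@mulfI _ p%:P); first by rewrite polyC_eq0.
  by rewrite mulrA -polyCM e eq mulrA [p%:P * _]mulrC.
- by rewrite (negPf pU).
Qed.

(** Each prime factor of [c] divides [g] or [h] and is divided out there; only constants are
    removed, so the sizes do not change. *)
Lemma split_factor c f g h : prime_product c -> c%:P * f = g * h ->
  exists g' h', [/\ f = g' * h', size g' = size g & size h' = size h].
Proof.
move=> pc; elim: pc g h => {c} [u uU|p c pp _ IH] g h e.
  exists (u^-1 *: g), h; split => //; last first.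
    by rewrite size_scale // unit_neq0 // unitrV.
  by rewrite -scalerAl -e mul_polyC scalerA mulVr // scale1r.
have [p0 _ _] := pp; have P0 : p%:P != 0 by rewrite polyC_eq0.
have [_ _ /(_ g h) []] := prime_polyC pp.
- by rewrite -e polyCM; exists (c%:P * f); rewrite -mulrA mulrC.
- move=> [g1 eg]; have [|g' [h' [ef sg sh]]] := IH g1 h.
    by apply: (mulfI P0); rewrite mulrA -polyCM e eg mulrA [p%:P * _]mulrC.
  by exists g', h'; split => //; rewrite sg eg mulrC mul_polyC size_scale.
- move=> [h1 eh]; have [|g' [h' [ef sg sh]]] := IH g h1.
    by apply: (mulfI P0); rewrite mulrA -polyCM e eh mulrA [RHS]mulrC.
  by exists g', h'; split => //; rewrite sh eh mulrC mul_polyC size_scale.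
Qed.

Hypothesis ufdR : factorial_ring R.

(* [gcdp] over a domain is a gcd up to nonzero constants; [primitive_dvd_cancel]
   and [split_factor] remove these constants. *)
Lemma primitive_irreducible_prime f : primitive f -> (1 < size f)%N ->
    (forall g h, f = g * h -> g \is a GRing.unit \/ h \is a GRing.unit) ->
  prime_elt f.
Proof.
move=> pf sf irr; have f0 : f != 0 by rewrite -size_poly_gt0 ltnW.
have size_unit g : g \is a GRing.unit -> size g = 1%N.
  by rewrite poly_unitE => /andP[/eqP].
have cancel g : f %| g -> rdvd f g.
  case/Pdiv.Idomain.dvdpP=> -[c q] /= c0; rewrite -mul_polyC.
  by apply: primitive_dvd_cancel => //; apply: ufdR.
split=> //; first by apply: contraTN sf => /size_unit ->.
move=> g h [q e].
have /Pdiv.Idomain.dvdpP[[c r] /= c0] := dvdp_gcdl f g.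
rewrite -mul_polyC => /(split_factor (ufdR c0)) [r' [d' [ef sr sd]]].
(* [d'] has the size of the gcd of [f] and [g]. If [r'] is a unit, the gcd is as large as [f], so
   [f] divides [g] up to a constant; if [d'] is a unit, the gcd is constant and [f] divides [h] up
   to a constant. *)
case: (irr _ _ ef) => /size_unit s1.
- left; apply: cancel; have : gcdp f g %= f.
    rewrite -dvdp_size_eqp ?dvdp_gcdl // -sd ef size_mul ?s1 //.
      by rewrite -size_poly_gt0 s1.
    by move: f0; rewrite ef mulf_eq0 negb_or => /andP[].
  by move/eqp_dvdl=> <-; rewrite dvdp_gcdr.
- right; apply: cancel.
  have cfg : coprimep f g by rewrite coprimep_def -sd s1.
  rewrite -(Gauss_dvdpr _ cfg); apply/Pdiv.Idomain.dvdpP.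
  by exists (1, q); rewrite ?oner_eq0 // scale1r.
Qed.

(** A primitive constant is a unit, so both factors in a proper factorization of [f] have positive
    degree and are shorter than [f]. *)
Lemma primitive_prime_product f : f != 0 -> primitive f -> prime_product f.
Proof.
have [n] := ubnP (size f); elim: n f => // n IH f sf f0 pf.
have [/size1_polyC ef|sf1] := leqP (size f) 1.
  apply: prime_product_unit.
  have : f`_0 \is a GRing.unit by apply: pf; exists 1; rewrite mul1r.
  by rewrite poly_unitE {2}ef size_polyC; move=> U; rewrite U unit_neq0.
case: (classic (exists g h,
    [/\ f = g * h, g \isn't a GRing.unit & h \isn't a GRing.unit])); last first.
  move=> red; rewrite -[f]mulr1; apply: prime_product_mul; last first.
    exact/prime_product_unit/unitr1.
  apply: primitive_irreducible_prime => // g h ef.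
  have [gU|gU] := boolP (g \is a GRing.unit); first by left.
  have [hU|hU] := boolP (h \is a GRing.unit); first by right.
  by case: red; exists g, h.
case=> g [h [ef gU hU]].
move: (f0); rewrite ef mulf_eq0 negb_or => /andP[g0 h0].
have pg : primitive g by apply: primitive_dvd pf; exists h; rewrite mulrC.
have ph : primitive h by apply: primitive_dvd pf; exists g.
have big k : k != 0 -> primitive k -> k \isn't a GRing.unit -> (1 < size k)%N.
  move=> k0 pk kU; rewrite ltnNge; apply: contra kU => /size1_polyC ek.
  have kU : k`_0 \is a GRing.unit by apply: pk; exists 1; rewrite mul1r.
  by rewrite poly_unitE {1}ek size_polyC kU unit_neq0.
have := big g g0 pg gU; have := big h h0 ph hU; move: sf.
rewrite ef size_mul // => sf sh sg.
by apply: prime_productM; apply: IH => //; lia.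
Qed.

Lemma primitive_part c f : prime_product c ->
    (forall a, rdvd a%:P f -> rdvd a c) ->
  exists a g, f = a%:P * g /\ primitive g.
Proof.
move=> pc; elim: pc f => {c} [u uU|p c [p0 pU pP] _ IH] f cf.
  by exists 1, f; rewrite mul1r; split=> // a /cf /rdvd_unit; apply.
case: (classic (rdvd p%:P f)) => [[f' ef]|npf].
  case: (IH f') => [a af|a [g [eg pg]]].
    case: (cf (a * p)) => [|q].
      by case: af => q eq; exists q; rewrite ef eq polyCM mulrA.
    rewrite [p * c]mulrC mulrA => /(mulIf p0) ->; by exists q.
  by exists (p * a), g; rewrite ef eg polyCM mulrC mulrA.
case: (IH f) => [a af|a [g ?]]; last by exists a, g.
have [q e] := cf _ af; case: (pP q a) => [|[r er]|pa].
- by rewrite -e; exists c; rewrite mulrC.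
- by exists r; apply: (mulfI p0); rewrite e er mulrAC mulrC.
- case: npf; apply: rdvd_trans af.
  by case: pa => r ->; exists r%:P; rewrite polyCM.
Qed.

Theorem factorial_poly : factorial_ring {poly R}.
Proof.
move=> f f0; have lf0 : lead_coef f != 0 by rewrite lead_coef_eq0.
(* The leading coefficient serves as the bound: every constant divisor of [f] divides it. *)
case: (primitive_part (f := f) (ufdR lf0)) => [a|a [g [ef pg]]].
  exact: rdvd_polyC_coef.
move: f0; rewrite ef mulf_eq0 negb_or polyC_eq0 => /andP[a0 g0].
apply: prime_productM; last exact: primitive_prime_product.
exact: prime_product_polyC (ufdR a0).
Qed.

End PolyFactorial.

(** * Transport along a ring isomorphism *)

Section Transport.
Variables (R S : idomainType) (phi : {rmorphism R -> S}) (psi : {rmorphism S ->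
  R}).
Hypotheses (phiK : cancel phi psi) (psiK : cancel psi phi).

Lemma rdvd_rmorph (a b : R) : rdvd a b -> rdvd (phi a) (phi b).
Proof. by case=> q ->; exists (phi q); rewrite rmorphM. Qed.

Lemma prime_elt_rmorph (p : R) : prime_elt p -> prime_elt (phi p).
Proof.
case=> p0 pU pP; split.
- by apply: contra_neq p0 => e; rewrite -[p]phiK e rmorph0.
- by apply: contra pU => /(rmorph_unit psi); rewrite phiK.
have back (a : S) : rdvd p (psi a) -> rdvd (phi p) a.
  by move/rdvd_rmorph; rewrite psiK.
move=> a b [q e]; case: (pP (psi a) (psi b)) => [|ha|hb].
- by exists (psi q); rewrite -rmorphM e rmorphM phiK.
- by left; apply: back.
- by right; apply: back.
Qed.

Lemma prime_product_rmorph (c : R) : prime_product c -> prime_product (phi c).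
Proof.
elim=> [u uU|p d pp _ IH]; first by apply/prime_product_unit/rmorph_unit.
by rewrite rmorphM; apply: prime_product_mul => //; apply: prime_elt_rmorph.
Qed.

End Transport.

(** * Polynomials in n+1 variables as polynomials in the last one *)

Section MpolyUni.
Variables (R : idomainType) (n : nat).

(** The inverse of [muni], as a ring morphism: the polynomial variable becomes the last
    indeterminate. *)
Definition mjoin : {poly {mpoly R[n]}} -> {mpoly R[n.+1]} :=
  horner_eval 'X_ord_max \o map_poly (@mwiden n R).

HB.instance Definition _ := GRing.RMorphism.on mjoin.

Lemma muniX (m : 'X_{1..n.+1}) : muni 'X_[R, m] =
  'X_[[multinom m (widen_ord (leqnSn n) i) | i < n]] *: 'X^(m ord_max).
Proof. by rewrite muniE msuppX big_seq1 mcoeffX eqxx scale1r. Qed.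

Lemma muni_mwiden (c : {mpoly R[n]}) : muni (mwiden c) = c%:P.
Proof.
rewrite [c in LHS]mpolyE [c in RHS]mpolyE (raddf_sum (@mwiden n R)).
rewrite (raddf_sum (@muni n R)) (raddf_sum polyC).
apply: eq_bigr => m _ /=; rewrite mwidenZ mwidenX muniZ muniX mnmwiden_ordmax
  expr0 -alg_polyC scalerA.
rewrite mul_mpolyC; congr ((_ *: 'X_[_])%:A); apply/mnmP => i.
by rewrite mnmE mnmwiden_widen.
Qed.

Lemma mjoinK : cancel mjoin (@muni n R).
Proof.
move=> q; elim/poly_ind: q => [|q c IH]; first by rewrite !rmorph0.
rewrite !rmorphD !rmorphM /= IH /mjoin /= map_polyX map_polyC /horner_eval.
rewrite hornerX hornerC muni_mwiden muniX; congr (q * _ + _).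
rewrite mnm1E eqxx expr1 -[RHS]scale1r; congr (_ *: _).
rewrite -mpolyX0; congr 'X_[_]; apply/mnmP=> i; rewrite !mnmE.
by rewrite -val_eqE /= gtn_eqF.
Qed.

Lemma muniK : cancel (@muni n R) mjoin.
Proof.
move=> p; rewrite [p in LHS]mpolyE [p in RHS]mpolyE (raddf_sum (@muni n R)).
rewrite (raddf_sum mjoin); apply: eq_bigr => m _ /=;
  rewrite muniZ muniX scalerA -mul_polyC /mjoin /=.
rewrite rmorphM /= map_polyC map_polyXn /horner_eval hornerM hornerC hornerXn.
rewrite /= mwidenM mwidenC mwidenX -mulrA mul_mpolyC; congr (_ *: _).
rewrite mpolyXn -mpolyXD; congr 'X_[_]; apply/mnmP => i.
rewrite mnmDE mulmnE mnm1E.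
case: (unliftP ord_max i) => [j|] ->.
  have -> : lift ord_max j = widen_ord (leqnSn n) j.
    by apply: ord_inj; rewrite lift_max.
  by rewrite mnmwiden_widen mnmE -val_eqE /= gtn_eqF // mul0n addn0.
by rewrite mnmwiden_ordmax eqxx mul1n.
Qed.

Lemma meval_muni (v : 'I_n.+1 -> R) (p : {mpoly R[n.+1]}) :
  p.@[v] =
  (map_poly (meval (fun i => v (widen_ord (leqnSn n) i))) (muni p)).[v ord_max].
Proof.
rewrite [p in LHS]mpolyE [p in RHS]mpolyE (raddf_sum (meval v)).
rewrite (raddf_sum (@muni n R)) (raddf_sum (map_poly _)) horner_sum.
apply: eq_bigr => m _ /=; rewrite mevalZ mevalX muniZ muniX scalerA.
rewrite map_polyZ map_polyXn hornerZ hornerXn /= mevalM mevalC mevalX -mulrA.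
congr (_ * _); rewrite big_ord_recr /=; congr (_ * _).
by apply: eq_bigr => i _; rewrite mnmE.
Qed.

End MpolyUni.

Lemma mpoly0_const (R : nzRingType) (p : {mpoly R[0]}) : p = (p@_0%MM)%:MP.
Proof.
apply/mpolyP=> m; rewrite mcoeffC; have -> : m = 0%MM by apply/mnmP=> -[].
by rewrite eqxx mulr1.
Qed.

Theorem factorial_mpoly (K : fieldType) (n : nat) : factorial_ring {mpoly K[n]}.
Proof.
elim: n => [|n IH] f f0.
  apply: prime_product_unit; rewrite (mpoly0_const f) rmorph_unit // unitfE.
  by apply: contra_neq f0 => e; rewrite (mpoly0_const f) e.
rewrite -[f]muniK; apply: (prime_product_rmorph (phi := @mjoin K n) (psi :=
  @muni n K)).
- exact: mjoinK.
- exact: muniK.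
apply: factorial_poly => //; apply: contra_neq f0 => e.
by rewrite -[f]muniK e rmorph0.
Qed.

(** * The Nullstellensatz for a hypersurface *)

Section Nullstellensatz.
Variable K : closedFieldType.

Lemma poly_eval0 (p : {poly K}) : (forall x, p.[x] = 0) -> p = 0.
Proof.
move=> p0; apply/eqP; apply: contraT => /closed_nonrootP[x].
by rewrite /root p0 eqxx.
Qed.

Definition vcons n (v : 'I_n -> K) (x : K) (i : 'I_n.+1) : K :=
  if unlift ord_max i is Some j then v j else x.

Lemma meval_vcons n (v : 'I_n -> K) (x : K) (p : {mpoly K[n.+1]}) :
  p.@[vcons v x] = (map_poly (meval v) (muni p)).[x].
Proof.
rewrite meval_muni /vcons unlift_none; congr (_.[x]).
apply: eq_map_poly => q; apply: meval_eq => i.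
have -> : widen_ord (leqnSn n) i = lift ord_max i.
  by apply: ord_inj; rewrite lift_max.
by rewrite liftK.
Qed.

(** A closed field is infinite: fixing all but the last coordinate gives a polynomial in one
    variable without a non-root, so each coefficient vanishes everywhere and induction applies. *)
Lemma meval_eq0 n (p : {mpoly K[n]}) : (forall v, p.@[v] = 0) -> p = 0.
Proof.
elim: n p => [|n IH] p p0.
  by move: (p0 (fun=> 0)); rewrite (mpoly0_const p) mevalC => ->.
apply: (can_inj (@muniK _ _)); rewrite rmorph0; apply/polyP=> i.
rewrite coef0; apply: IH => v; rewrite -coef_map.
have -> : map_poly (meval v) (muni p) = 0; last by rewrite coef0.
by apply: poly_eval0 => x; rewrite -meval_vcons.
Qed.

Lemma polyC_prime (R : idomainType) (c : R) : prime_elt c%:P -> prime_elt c.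
Proof.
case; rewrite polyC_eq0 => c0 cU cP; split=> //.
  by apply: contra cU => cU; apply: rmorph_unit.
move=> a b [q e]; case: (cP a%:P b%:P) => [|ca|cb].
- by exists q%:P; rewrite -!polyCM e.
- by left; have := rdvd_polyC_coef 0 ca; rewrite coefC.
- by right; have := rdvd_polyC_coef 0 cb; rewrite coefC.
Qed.

(** [f] and [h] are coprime over the fraction field. Clearing denominators in a Bezout relation
    gives a nonzero constant [r = u * f + v * h], which plays the role of a resultant. *)
Lemma prime_elimination (R : idomainType) (f h : {poly R}) :
    prime_elt f -> (1 < size f)%N -> ~ rdvd f h ->
  exists2 r, r != 0 &
    forall (F : fieldType) (phi : {rmorphism R -> F}) (x : F),
    (map_poly phi f).[x] = 0 -> (map_poly phi h).[x] = 0 -> phi r = 0.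
Proof.
move=> [f0 fU fP] sf nfh.
have fC (c : R) : c != 0 -> ~ rdvd f c%:P.
  move=> c0 [q e]; have q0 : q != 0.
    by apply: contra_neq c0 => q0; apply: polyC_inj; rewrite e q0 mul0r.
  have := size_mul q0 f0; rewrite -e size_polyC c0.
  by move: q0; rewrite -size_poly_gt0; lia.
have s1 : size (gcdp f h) == 1%N.
  have /Pdiv.Idomain.dvdpP[[c q] /= c0] := dvdp_gcdl f h.
  have /Pdiv.Idomain.dvdpP[[c' q'] /= c'0] := dvdp_gcdr f h.
  rewrite -!mul_polyC => eh ef.
  (* If [f] divides [q], cancelling [f] shows that the gcd divides the constant [c]. Otherwise [f]
     divides the gcd, hence [c' * h], hence [h], which is excluded. *)
  case: (fP q (gcdp f h)) => [|[r er]|[r er]]; first by exists c%:P.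
    have e : c%:P = r * gcdp f h.
      by apply: (mulIf f0); rewrite ef er mulrAC.
    have : size (r * gcdp f h) = 1%N by rewrite -e size_polyC c0.
    by move/eqP; rewrite size_mul_eq1 => /andP[].
  case: (fP c'%:P h) => [|/(fC _ c'0)|] //.
  by rewrite eh er; exists (q' * r); rewrite mulrA.
have [[u v] /= /eqp_size] := Bezoutp f h; rewrite (eqP s1) => s.
have /size_poly1P[r r0 er] : size (u * f + v * h) == 1%N by apply/eqP.
exists r => // F phi x fx hx.
have := congr1 (fun q => (map_poly phi q).[x]) er.
rewrite rmorphD !rmorphM /= map_polyC hornerD !hornerM fx hx hornerC.
by rewrite !mulr0 addr0.
Qed.

(* If [f] did not divide [h], eliminating the last variable would give a nonzero
   [r] in the other variables that vanishes wherever the leading coefficient of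
   [f] does not. *)
Theorem hypersurface_Nullstellensatz n (f h : {mpoly K[n]}) :
    prime_elt f -> (forall v, f.@[v] = 0 -> h.@[v] = 0) -> rdvd f h.
Proof.
elim: n f h => [|n IH] f h pf fh.
  case: pf => f0; rewrite (mpoly0_const f) rmorph_unit // unitfE.
  by apply: contra_neq f0 => e; rewrite (mpoly0_const f) e.
have pF : prime_elt (muni f).
  have lift := @prime_elt_rmorph {mpoly K[n.+1]} {poly {mpoly K[n]}}
    (@muni n K) (@mjoin K n).
  exact: lift (@muniK K n) (@mjoinK K n) f pf.
suff [q e] : rdvd (muni f) (muni h).
  by exists (mjoin q); rewrite -[h]muniK e rmorphM /= muniK.
(* If [f] is free of the last variable, every coefficient of [h] in that variable vanishes on the
   zeros of [f], and induction applies to each. *)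
have [/size1_polyC eF|sF] := leqP (size (muni f)) 1.
  rewrite eF; apply: rdvd_polyC => i; apply: IH.
    by apply: polyC_prime; rewrite -eF.
  move=> v fv; rewrite -coef_map.
  have -> : map_poly (meval v) (muni h) = 0; last by rewrite coef0.
  apply: poly_eval0 => x; rewrite -meval_vcons; apply: fh.
  by rewrite meval_vcons eF map_polyC hornerC.
apply: NNPP => nFH.
have [r r0 elim_r] := prime_elimination pF sF nFH.
have lF : lead_coef (muni f) != 0 by case: pF; rewrite lead_coef_eq0.
case/eqP: (mulf_neq0 lF r0); apply: meval_eq0 => v; rewrite mevalM.
have [->|lv] := eqVneq (lead_coef (muni f)).@[v] 0; first by rewrite mul0r.
have sv : size (map_poly (meval v) (muni f)) = size (muni f).
  by rewrite size_poly_eq.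
have /closed_rootP[x /eqP fx] : size (map_poly (meval v) (muni f)) != 1%N.
  by rewrite sv gtn_eqF.
have hx : (map_poly (meval v) (muni h)).[x] = 0.
  by rewrite -meval_vcons fh // meval_vcons.
by rewrite (elim_r K (meval v) x fx hx) mulr0.
Qed.

End Nullstellensatz.

(** * Binary forms and projectivities of the line *)

Section Forms.
Variable K : fieldType.

Lemma dhomog_meval n e (p : {mpoly K[n]}) (c : K) (v w : 'I_n -> K) :
  p \is e.-homog -> (forall i, w i = c * v i) -> p.@[w] = c ^+ e * p.@[v].
Proof.
move=> hp ew; rewrite !mevalE mulr_sumr; apply: eq_big_seq => m mp.
rewrite mulrCA; congr (_ * _); rewrite -(dhomog_mf hp mp) /= mdegE -prodrXr.
by rewrite -big_split; apply: eq_bigr => i _; rewrite ew exprMn.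
Qed.

Lemma dhomog_mevalZ n e (p : {mpoly K[n]}) (c : K) (x : 'rV_n) :
  p \is e.-homog -> p.@[(c *: x) 0] = c ^+ e * p.@[x 0].
Proof. by move=> hp; apply: dhomog_meval hp _ => i; rewrite mxE. Qed.

Lemma eval_formsE n m (F : m.-tuple {mpoly K[n]}) x i :
  eval_forms F x 0 i = (tnth F i).@[x 0].
Proof. by rewrite mxE. Qed.

Lemma eval_formsZ n m e (F : m.-tuple {mpoly K[n]}) (c : K) x :
  forms e F -> eval_forms F (c *: x) = c ^+ e *: eval_forms F x.
Proof. by move=> hF; apply/rowP=> i; rewrite !mxE (dhomog_mevalZ _ _ (hF i)).
  Qed.

Lemma meval_comp_forms n m (p : {mpoly K[m]}) (F : m.-tuple {mpoly K[n]}) (x :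
  'rV_n) :
  (p \mPo F).@[x 0] = p.@[eval_forms F x 0].
Proof. by rewrite comp_mpoly_meval; apply: meval_eq => i; rewrite mxE. Qed.

Lemma dhomog_comp n m e k (p : {mpoly K[m]}) (F : m.-tuple {mpoly K[n]}) :
  p \is e.-homog -> forms k F -> p \mPo F \is (e * k).-homog.
Proof.
move=> hp hF; rewrite comp_mpolyEX big_seq; apply: rpred_sum => mm mp.
apply: rpredZ; rewrite comp_mpolyX -(dhomog_mf hp mp) /= mdegE big_distrl /=.
elim: (index_enum _) => [|i r IH]; first by rewrite !big_nil dhomog1.
by rewrite !big_cons; apply: dhomogM IH; rewrite mulnC; apply: dhomogMn (hF i).
Qed.

End Forms.

(** * Binary forms as products of linear forms *)

Section BinaryForms.
Variable K : closedFieldType.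

Lemma big_ord2 (R : Type) (idx : R) (op : Monoid.law idx) (F : 'I_2 -> R) :
  \big[op/idx]_(i < 2) F i = op (F ord0) (F ord_max).
Proof.
rewrite big_ord_recr big_ord1 /=; congr (op (F _) _); exact: val_inj.
Qed.

(** [p * 'X_i] vanishes everywhere. This allows forms to be compared on one affine chart only. *)
Lemma meval_eq0_off n (p : {mpoly K[n]}) (i : 'I_n) :
  (forall v, v i != 0 -> p.@[v] = 0) -> p = 0.
Proof.
move=> p0; have /eqP : p * 'X_i = 0.
  apply: meval_eq0 => v; rewrite mevalM mevalXU.
  by have [->|/p0 ->] := eqVneq (v i) 0; rewrite ?mulr0 ?mul0r.
rewrite mulf_eq0 => /orP[/eqP //|/eqP X0].
by have := mevalXU (fun=> 1 : K) i; rewrite X0 meval0 => /eqP;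
  rewrite eq_sym oner_eq0.
Qed.

Definition linform (V : lmodType K) (l : K * K) (p q : V) : V :=
  l.1 *: p + l.2 *: q.

Lemma binary_form_factor m (A : {mpoly K[2]}) : A \is m.-homog -> A != 0 ->
  exists (c : K) (s : seq (K * K)), [/\ c != 0, size s = m,
    forall l, l \in s -> l != (0, 0) &
    forall v, A.@[v] =
      c * \prod_(l <- s) (l.1 * v ord0 + l.2 * v ord_max)].
Proof.
move=> hA A0.
(* The dehomogenization [A(X, 1)]. *)
pose a : {poly K} := \sum_(mm <- msupp A) A@_mm *: 'X^(mm ord0).
have deg mm : mm \in msupp A -> m = (mm ord0 + mm ord_max)%N.
  by move=> /(dhomog_mf hA) <- /=; rewrite mdegE big_ord2.
have sa : (size a <= m.+1)%N.
  rewrite /a big_seq; apply: (big_ind (fun p : {poly K} => size p <= m.+1)%N).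
  - by rewrite size_poly0.
  - by move=> p q sp sq; apply: leq_trans (size_polyD _ _) _;
      rewrite geq_max sp.
  move=> mm /deg em; apply: leq_trans (size_scale_leq _ _) _.
  by rewrite size_polyXn em ltnS leq_addr.
have evA v : v ord_max != 0 -> A.@[v] = v ord_max ^+ m * a.[v ord0 / v ord_max].
  move=> v1; rewrite mevalE horner_sum mulr_sumr;
    apply: eq_big_seq => mm /deg em.
  rewrite big_ord2 /= hornerZ hornerXn [RHS]mulrCA em exprD expr_div_n;
    congr (_ * _).
  by field; rewrite expf_neq0.
have a0 : a != 0.
  apply: contra_neq A0 => a0; apply: (@meval_eq0_off _ _ ord_max) => v v1.
  by rewrite evA // a0 horner0 mulr0.
have [r er] := closed_field_poly_normal a.
have sr : (size r <= m)%N.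
  move: sa; rewrite er size_scale ?lead_coef_eq0 //.
  by rewrite size_prod_XsubC ltnS.
(* The degree lost by dehomogenizing is the multiplicity of the zero at infinity [(1 : 0)], restored
   by copies of the linear form ['X_ord_max]. *)
pose s := [seq (1, - z) | z <- r] ++ nseq (m - size r) (0 : K, 1 : K).
pose B : {mpoly K[2]} := (lead_coef a)%:MP *
  \prod_(l <- s) (l.1%:MP * 'X_ord0 + l.2%:MP * 'X_ord_max).
have evB v : B.@[v] =
    lead_coef a * \prod_(l <- s) (l.1 * v ord0 + l.2 * v ord_max).
  rewrite /B mevalM mevalC rmorph_prod /=; congr (_ * _).
  by apply: eq_bigr => l _; rewrite mevalD !mevalM !mevalC !mevalXU.
exists (lead_coef a), s; split.
- by rewrite lead_coef_eq0.
- by rewrite size_cat size_map size_nseq subnKC.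
- move=> l; rewrite mem_cat => /orP[/mapP[z _ ->]|/nseqP[-> _]].
    by rewrite xpair_eqE oner_eq0.
  by rewrite xpair_eqE oner_eq0 andbF.
move=> v; rewrite -evB; congr (_.@[v]); apply/eqP; rewrite -subr_eq0; apply/eqP.
apply: (@meval_eq0_off _ _ ord_max) => {}v v1; rewrite mevalB evB evA //.
rewrite big_cat big_map /= big_nseq mul0r add0r mul1r iter_mulr_1 /= mul1r.
have -> : \prod_(z <- r) (v ord0 + - z * v ord_max) =
          v ord_max ^+ size r * \prod_(z <- r) (v ord0 / v ord_max - z).
  elim: (r) => [|z t IHt]; first by rewrite !big_nil mulr1.
  by rewrite !big_cons IHt exprS; field.
have -> : a.[v ord0 / v ord_max] =
    lead_coef a * \prod_(z <- r) (v ord0 / v ord_max - z).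
  rewrite {1}er hornerZ horner_prod; congr (_ * _).
  by apply: eq_bigr => z _; rewrite hornerXsubC.
rewrite -[in v ord_max ^+ m](subnKC sr) exprD; ring.
Qed.

(** Two linear forms with a common nonzero zero have determinant [l1 * m2 - l2 * m1] equal to 0. *)
Lemma linform_proportional (a b : K) (l m : K * K) : (a != 0) || (b != 0) ->
    l != (0, 0) -> m != (0, 0) ->
    l.1 * a + l.2 * b = 0 -> m.1 * a + m.2 * b = 0 ->
  exists2 k, k != 0 & m = (k * l.1, k * l.2).
Proof.
case: l m => [l1 l2] [m1 m2] /= ab0; rewrite !xpair_eqE !negb_and => l0 m0 el
  em.
have d0 : l1 * m2 = l2 * m1.
  case/orP: ab0 => n0; apply: (mulfI n0).
    apply/eqP; rewrite -subr_eq0; apply/eqP.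
    have -> : a * (l1 * m2) - a * (l2 * m1) =
      m2 * (l1 * a + l2 * b) - l2 * (m1 * a + m2 * b) by ring.
    by rewrite el em !mulr0 subr0.
  apply/eqP; rewrite -subr_eq0; apply/eqP.
  have -> : b * (l1 * m2) - b * (l2 * m1) =
    l1 * (m1 * a + m2 * b) - m1 * (l1 * a + l2 * b) by ring.
  by rewrite el em !mulr0 subr0.
have [l10|l10] := eqVneq l1 0.
  move: l0 d0; rewrite l10 eqxx mul0r /= => l20 /esym/eqP.
  rewrite mulf_eq0 (negPf l20) /= => /eqP m10; move: m0;
    rewrite m10 eqxx /= => m20.
  exists (m2 / l2); first by rewrite mulf_neq0 ?invr_eq0.
  by rewrite mulr0 divfK.
exists (m1 / l1).
  rewrite mulf_neq0 ?invr_eq0 //; apply/negP => /eqP m10; move: m0 d0.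
  rewrite m10 eqxx mulr0 /= => m20 /eqP.
  by rewrite mulf_eq0 (negPf l10) (negPf m20).
rewrite divfK //; congr (_, _); apply: (mulfI l10); rewrite d0; by field.
Qed.

(* A factor of the right-hand side that is not constant at [(p, q)] has a root,
   where some factor on the left vanishes too; as [p] and [q] have no common
   root the two linear forms are proportional and cancel.  Once the factors on
   the right are constant, exactly one factor on the left has degree 1. *)
Lemma linforms_span (p q : {poly K}) (c1 c2 : K) (s1 s2 : seq (K * K)) :
    coprimep p q -> size s1 = size s2 ->
    (forall l, l \in s1 -> l != (0, 0)) -> (forall l, l \in s2 -> l != (0, 0))
      ->
    c1 *: \prod_(l <- s1) linform l p q =
      c2 *: 'X * \prod_(l <- s2) linform l p q ->
    c1 *: \prod_(l <- s1) linform l p q != 0 ->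
  exists a b, linform a p q = 'X /\ linform b p q = 1.
Proof.
move=> cpq; have [n] := ubnP (size s1); elim: n s1 s2 c1 => // n IH s1 s2 c1.
move=> sn es n1 n2 e nz.
have [/hasP[l ls2 sl]|/hasPn s2C] :=
  boolP (has (fun l => (1 < size (linform l p q))%N) s2).
  have /closed_rootP[x /eqP lx] : size (linform l p q) != 1%N by rewrite
    gtn_eqF.
  have c10 : c1 != 0 by apply: contra_neq nz => ->; rewrite scale0r.
  have : (\prod_(l <- s1) linform l p q).[x] == 0.
    have := congr1 (fun r => r.[x]) e; rewrite /= hornerZ hornerM.
    rewrite (big_rem l ls2) //= hornerM lx mul0r mulr0 => /eqP.
    by rewrite mulf_eq0 (negPf c10).
  rewrite horner_prod prodf_seq_eq0 => /hasP[m ms1 /= /eqP mx].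
  have pq0 : (p.[x] != 0) || (q.[x] != 0).
    have [px|] := eqVneq p.[x] 0; last by [].
    by rewrite (coprimep_root cpq) //; apply/eqP.
  have [k k0 em] : exists2 k, k != 0 & m = (k * l.1, k * l.2).
    apply: (linform_proportional pq0 (n2 l ls2) (n1 m ms1)).
      by move: lx; rewrite /linform hornerD !hornerZ.
    by move: mx; rewrite /linform hornerD !hornerZ.
  have emL : linform m p q = k *: linform l p q.
    by rewrite em /linform /= scalerDr !scalerA.
  have lL0 : linform l p q != 0 by rewrite -size_poly_gt0 ltnW.
  have e' : linform l p q * ((c1 * k) *: \prod_(l <- rem m s1) linform l p q) =
    linform l p q * (c2 *: 'X * \prod_(l <- rem l s2) linform l p q).
    move: e; rewrite (big_rem m ms1) //= (big_rem l ls2) //= emL.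
    rewrite -!scalerAl scalerA -!scalerAr => ->.
    by rewrite mulrCA.
  apply: (IH (rem m s1) (rem l s2) (c1 * k)).
  - by rewrite size_rem //; move: sn ms1; case: (s1).
  - by rewrite !size_rem // es.
  - by move=> l' /mem_rem/n1.
  - by move=> l' /mem_rem/n2.
  - exact: (mulfI lL0).
  - rewrite scaler_eq0 !negb_or mulf_neq0 //=.
    by move: nz; rewrite scaler_eq0 negb_or (big_rem m ms1) //= mulf_eq0
      !negb_or => /and3P[].
have P2 : (size (\prod_(l <- s2) linform l p q)%R <= 1)%N.
  rewrite big_seq; apply: (big_ind (fun r : {poly K} => size r <= 1)%N).
  - by rewrite size_poly1.
  - by move=> r r' sr sr'; apply: leq_trans (size_polyMleq _ _) _; lia.
  - by move=> l /s2C; rewrite -leqNgt.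
(* Otherwise the left-hand side would be constant, while the right-hand side is a nonzero multiple
   of ['X]. *)
have [m ms1 sm] : exists2 m, m \in s1 & (1 < size (linform m p q))%N.
  apply/hasP; apply: contraT => /hasPn s1C.
  have : (size (c1 *: \prod_(l <- s1) linform l p q)%R <= 1)%N.
    apply: leq_trans (size_scale_leq _ _) _.
    rewrite big_seq; apply: (big_ind (fun r : {poly K} => size r <= 1)%N).
    - by rewrite size_poly1.
    - by move=> r r' sr sr'; apply: leq_trans (size_polyMleq _ _) _; lia.
    - by move=> l /s1C; rewrite -leqNgt.
  move: nz; rewrite e -scalerAl => nz.
  move: (nz); rewrite scaler_eq0 negb_or mulf_eq0 negb_or => /and3P[c20 X0 P0].
  by rewrite size_scale // size_mul // size_polyX; move: P0;
    rewrite -size_poly_gt0; lia.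
have sm2 : size (linform m p q) = 2.
  apply/eqP; rewrite eqn_leq sm andbT.
  have : linform m p q %| c1 *: \prod_(l <- s1) linform l p q.
    by rewrite (big_rem m ms1) //= scalerAr dvdp_mulr.
  move/(dvdp_leq nz)/leq_trans; apply; rewrite e.
  apply: leq_trans (size_polyMleq _ _) _.
  have sX : (size (c2 *: 'X : {poly K}) <= 2)%N.
    by rewrite (leq_trans (size_scale_leq _ _)) // size_polyX.
  by move: (leq_add sX P2); case: (_ + _)%N.
have [l ls2] : exists l, l \in s2.
  by case: (s2) es => [|l t _]; [case: (s1) ms1|exists l; rewrite mem_head].
have lL0 : linform l p q != 0.
  move: nz; rewrite e (big_rem l ls2) //= mulf_eq0 negb_or => /andP[_].
  by rewrite mulf_eq0 negb_or => /andP[].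
have /size1_polyC : (size (linform l p q) <= 1)%N by rewrite leqNgt s2C.
set k := _`_0 => ek.
have k0 : k != 0 by move: lL0; rewrite ek polyC_eq0.
have size2 (M : {poly K}) : size M = 2 -> M = M`_1 *: 'X + (M`_0)%:P /\ M`_1 !=
  0.
  move=> sM; split; last first.
    have := lead_coef_eq0 M; rewrite lead_coefE -size_poly_eq0 sM /=.
    by move=> ->.
  apply/polyP=> -[|[|i]]; rewrite coefD coefZ coefX coefC /=.
  - by rewrite mulr0 add0r.
  - by rewrite mulr1 addr0.
  - by rewrite mulr0 addr0 nth_default // sM.
set M := linform m p q in sm2; have [eM M1] := size2 M sm2.
(* The form [l] takes the constant value [k], so [1] is [l / k], and ['X] is obtained by solving
   [M = M1 X + M0] with [M0] written as [M0 / k] times [l]. *)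
exists ((m.1 - M`_0 / k * l.1) / M`_1, (m.2 - M`_0 / k * l.2) / M`_1).
exists (l.1 / k, l.2 / k); split; last first.
  have -> : linform (l.1 / k, l.2 / k) p q = k^-1 *: linform l p q.
    by rewrite /linform /= scalerDr !scalerA ![k^-1 * _]mulrC.
  by rewrite ek scale_polyC mulVf.
transitivity ((M`_1)^-1 *: (M - (M`_0 / k) *: linform l p q)); last first.
  by rewrite ek scale_polyC divfK // {2}eM addrK scalerA mulVf // scale1r.
move: (M`_0 / k) (M`_1)^-1 => u w; rewrite /M /linform /=.
by rewrite -!mul_polyC !(polyCM, polyCB); ring.
Qed.

End BinaryForms.

(** * Self-maps of the line with a rational retraction *)

Section Projectivity.
Variable K : closedFieldType.

Definition affine_pt (x : K) : 'rV[K]_2 := \row_i (if i == ord_max then x else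
  1).

(** The dehomogenization [A(1, X)], on the chart of [affine_pt]. *)
Definition slice (A : {mpoly K[2]}) : {poly K} :=
  map_poly (meval (fun _ : 'I_1 => 1)) (muni A).

Lemma slice_eval (A : {mpoly K[2]}) x : (slice A).[x] = A.@[affine_pt x 0].
Proof.
rewrite /slice -meval_vcons; apply: meval_eq => i; rewrite mxE /vcons.
case: unliftP => [j|] ->; last by rewrite eqxx.
by rewrite eq_sym (negPf (neq_lift _ _)).
Qed.

Lemma affine_ptZ (v : 'I_2 -> K) i :
  v ord0 != 0 -> v i = v ord0 * affine_pt (v ord_max / v ord0) 0 i.
Proof.
move=> v0; rewrite mxE; case: eqP => [->|/eqP i1]; first by rewrite mulrC divfK.
by rewrite mulr1; congr (v _); apply: val_inj; case: i i1 => -[|[]].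
Qed.

Lemma row2_neq0 (s : 'rV[K]_2) :
  s != 0 -> (s 0 ord0 != 0) || (s 0 ord_max != 0).
Proof.
apply: contraNT; rewrite negb_or !negbK => /andP[/eqP s0 /eqP s1].
apply/eqP/rowP => i; rewrite [RHS]mxE.
case: (unliftP ord_max i) => [j|] -> //.
by rewrite -[RHS]s0; congr (s _ _); rewrite (ord1 j); apply: val_inj.
Qed.

(** By Cramer's rule [b.2 X - a.2] and [b.1 X - a.1] are multiples of the determinant; if it were 0,
    then [b] would be 0, against [linform b p q = 1]. *)
Lemma linform_det (p q : {poly K}) (a b : K * K) :
    linform a p q = 'X -> linform b p q = 1 ->
  a.1 * b.2 - a.2 * b.1 != 0.
Proof.
move=> ea eb; apply/eqP => d0.
have key (r : {poly K}) (x y : K) : x *: 'X - y *: 1 = (a.1 * b.2 - a.2 * b.1)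
  *: r ->
    x = 0 /\ y = 0.
  rewrite d0 scale0r => /polyP e; split.
    by have := e 1%N; rewrite coefB !coefZ coefX coef1 coef0 mulr1 mulr0 subr0.
  have := e 0%N; rewrite coefB !coefZ coefX coef1 coef0 mulr1 mulr0 sub0r.
  by move/eqP; rewrite oppr_eq0 => /eqP.
have [b20 a20] : b.2 = 0 /\ a.2 = 0.
  apply: (key p); rewrite -ea -eb /linform -!mul_polyC !(polyCM, polyCB); ring.
have [b10 a10] : b.1 = 0 /\ a.1 = 0.
  apply: (key (- q)); rewrite -ea -eb /linform -!mul_polyC !(polyCM, polyCB);
    ring.
move/eqP: eb; rewrite /linform b10 b20 !scale0r addr0 eq_sym.
by rewrite oner_eq0.
Qed.

Lemma retraction_projectivity m k e (Phi Psi : 2.-tuple {mpoly K[2]}) W :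
    forms k Phi -> forms m Psi -> W \is e.-homog -> W != 0 ->
    (forall t : 'rV_2, t != 0 -> W.@[t 0] != 0 ->
       eval_forms Phi t != 0 /\ proj_eq t (eval_forms Psi (eval_forms Phi t)))
         ->
  exists a b : K * K, a.1 * b.2 - a.2 * b.1 != 0 /\
    forall t : 'rV_2,
      (a.1 * eval_forms Phi t 0 ord0 + a.2 * eval_forms Phi t 0 ord_max) * t 0
        ord0 =
      (b.1 * eval_forms Phi t 0 ord0 + b.2 * eval_forms Phi t 0 ord_max) * t 0
        ord_max.
Proof.
move=> hPhi hPsi hW W0 sec.
have [P evP] : exists P : {poly K},
    forall x, P.[x] = eval_forms Phi (affine_pt x) 0 ord0.
  by exists (slice (tnth Phi ord0)) => x; rewrite slice_eval mxE.
have [Q evQ] : exists Q : {poly K},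
    forall x, Q.[x] = eval_forms Phi (affine_pt x) 0 ord_max.
  by exists (slice (tnth Phi ord_max)) => x; rewrite slice_eval mxE.
have [w evw] : exists w : {poly K}, forall x, w.[x] = W.@[affine_pt x 0].
  by exists (slice W) => x; rewrite slice_eval.
have w0 : w != 0.
  apply: contra_neq W0 => w0; apply: (@meval_eq0_off _ _ _ ord0) => v v0.
  rewrite (dhomog_meval hW (fun i => affine_ptZ i v0)) -evw w0.
  by rewrite horner0 mulr0.
have aff x : w.[x] != 0 -> exists c, [/\ c != 0, (P.[x] != 0) || (Q.[x] != 0),
    (tnth Psi ord0).@[eval_forms Phi (affine_pt x) 0] = c &
    (tnth Psi ord_max).@[eval_forms Phi (affine_pt x) 0] = x * c].
  move=> wx; case: (sec (affine_pt x)) => [||s0 [c c0 ec]].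
  - by apply/eqP => /rowP/(_ ord0)/eqP; rewrite !mxE oner_eq0.
  - by rewrite -evw.
  exists c; split => //.
  - by rewrite evP evQ; apply: row2_neq0.
  - by rewrite -eval_formsE ec !mxE mulr1.
  - by rewrite -eval_formsE ec !mxE eqxx mulrC.
(* With [x0] nonzero, both values [c] and [x0 * c] of [Psi] are nonzero, so both components are
   nonzero forms and can be factored. *)
have [x0] : exists x, ~~ root (w * 'X) x.
  by apply/closed_nonrootP; rewrite mulf_neq0 ?polyX_eq0.
rewrite rootM negb_or rootX => /andP[/[dup] wx0 /aff[c [c0 PQ0 e1 e2]] x00].
have [c1 [s1 [c10 sz1 n1 f1]]] : exists (c : K) (s : seq (K * K)),
    [/\ c != 0, size s = m, forall l, l \in s -> l != (0, 0) &
    forall v, (tnth Psi ord0).@[v] =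
      c * \prod_(l <- s) (l.1 * v ord0 + l.2 * v ord_max)].
  apply: binary_form_factor => //.
  by apply: contra_neq c0 => z; rewrite -e1 z meval0.
have [c2 [s2 [c20 sz2 n2 f2]]] : exists (c : K) (s : seq (K * K)),
    [/\ c != 0, size s = m, forall l, l \in s -> l != (0, 0) &
    forall v, (tnth Psi ord_max).@[v] =
      c * \prod_(l <- s) (l.1 * v ord0 + l.2 * v ord_max)].
  apply: binary_form_factor => //.
  by apply: contra_neq (mulf_neq0 x00 c0) => z; rewrite -e2 z meval0.
pose g := gcdp P Q; pose p := P %/ g; pose q := Q %/ g.
have eP : P = p * g by rewrite divpK // dvdp_gcdl.
have eQ : Q = q * g by rewrite divpK // dvdp_gcdr.
have cpq : coprimep p q.
  apply: coprimep_div_gcd; case/orP: PQ0 => n0; apply/orP; [left|right];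
    by apply: contra_neq n0 => ->; rewrite horner0.
have ev s x : \prod_(l <- s) (l.1 * P.[x] + l.2 * Q.[x]) =
    g.[x] ^+ size s * (\prod_(l <- s) linform l p q).[x].
  elim: s => [|l s IH]; first by rewrite !big_nil hornerC mulr1.
  rewrite !big_cons IH exprS hornerM /linform hornerD !hornerZ eP eQ !hornerM.
  ring.
have ev1 x : (tnth Psi ord0).@[eval_forms Phi (affine_pt x) 0] =
    g.[x] ^+ m * (c1 * (\prod_(l <- s1) linform l p q).[x]).
  by rewrite f1 -evP -evQ ev sz1 mulrCA.
have ev2 x : (tnth Psi ord_max).@[eval_forms Phi (affine_pt x) 0] =
    g.[x] ^+ m * (c2 * (\prod_(l <- s2) linform l p q).[x]).
  by rewrite f2 -evP -evQ ev sz2 mulrCA.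
have g0 : g != 0.
  apply: contraTneq PQ0 => z; rewrite eP eQ z !mulr0 horner0 eqxx.
  by [].
(* Where [w] and [g] do not vanish, the retraction identity gives this after cancelling [g.[x] ^+
   m]; multiplied by [w * g], the difference vanishes everywhere. *)
have e12 : c2 *: \prod_(l <- s2) linform l p q =
           c1 *: 'X * \prod_(l <- s1) linform l p q.
  apply/eqP; rewrite -subr_eq0; have := mulf_neq0 w0 g0;
    apply: contra_neqT => n0.
  apply/eqP; apply: contraT => wg0; case/negP: (mulf_neq0 wg0 n0); apply/eqP.
  apply: poly_eval0 => x; rewrite !hornerM hornerD hornerN hornerM !hornerZ
    hornerX.
  have [->|wx] := eqVneq w.[x] 0; first by rewrite !mul0r.
  have [->|gx] := eqVneq g.[x] 0; first by rewrite mulr0 mul0r.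
  case: (aff x wx) => d [_ _ d1 d2].
  have -> : c2 * (\prod_(l <- s2) linform l p q).[x] =
            x * (c1 * (\prod_(l <- s1) linform l p q).[x]).
    by apply: (mulfI (expf_neq0 m gx)); rewrite -ev2 d2 -d1 ev1 mulrCA.
  by rewrite mulrA [x * c1]mulrC subrr mulr0.
have nz : c2 *: \prod_(l <- s2) linform l p q != 0.
  have := mulf_neq0 x00 c0; rewrite -e2 ev2; apply: contra_neq => z.
  by rewrite -hornerZ z horner0 mulr0.
have [|a [b [ea eb]]] := linforms_span cpq _ n2 n1 e12 nz; first by rewrite sz1.
exists a, b; split; first exact: linform_det ea eb.
have val l x : l.1 * P.[x] + l.2 * Q.[x] = (linform l p q).[x] * g.[x].
  by rewrite /linform hornerD !hornerZ eP eQ !hornerM; ring.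
(* At [(1, x)] the two combinations of [Phi] are [x * g.[x]] and [g.[x]], so the form [D] vanishes
   on the chart and hence identically. *)
pose D : {mpoly K[2]} :=
  (a.1 *: tnth Phi ord0 + a.2 *: tnth Phi ord_max) * 'X_ord0 -
  (b.1 *: tnth Phi ord0 + b.2 *: tnth Phi ord_max) * 'X_ord_max.
suff D0 : D = 0.
  move=> t; apply/eqP; rewrite -subr_eq0 !mxE; apply/eqP.
  have := congr1 (meval (t 0)) D0.
  by rewrite meval0 /D mevalB !mevalM !mevalD !mevalZ !mevalXU.
have hD : D \is (k + 1).-homog.
  have hX i : ('X_i : {mpoly K[2]}) \is 1.-homog by rewrite dhomogX /= mdeg1.
  by apply: rpredB; apply: dhomogM => //; apply: rpredD; apply: rpredZ;
    apply: hPhi.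
apply: (@meval_eq0_off _ _ _ ord0) => v v0.
rewrite (dhomog_meval hD (fun i => affine_ptZ i v0)).
rewrite mevalB !mevalM !mevalD !mevalZ !mevalXU.
set x := _ / _; rewrite -!eval_formsE -evP -evQ !val ea eb hornerX hornerC !mxE
  eqxx /=.
ring.
Qed.

End Projectivity.

(** * Plane curves *)

Section PlaneCurve.
Variables (K : closedFieldType) (n : nat) (C : 'rV[K]_n -> Prop) (f : {mpoly
  K[n]}).
Hypotheses (pf : prime_elt f) (CE : forall x, C x <-> proj_space x /\ f.@[x 0]
  = 0).

(** The affine zero set of [f] may contain the origin, which [C] omits. There [H] takes the value
    [0 ^+ e] times its value at [x0], which is 0 even when [e] is 0. *)
Lemma vanishing_form_dvd e (H : {mpoly K[n]}) x0 : C x0 -> H \is e.-homog ->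
  (forall x, C x -> H.@[x 0] = 0) -> rdvd f H.
Proof.
move=> Cx0 hH H0; apply: hypersurface_Nullstellensatz => // v fv.
pose x : 'rV[K]_n := \row_i v i.
have xv i : x 0 i = v i by rewrite mxE.
rewrite -(meval_eq _ xv); have [x_0|nx0] := eqVneq x 0; last first.
  by apply: H0; apply/CE; split=> //; rewrite (meval_eq _ xv).
by rewrite x_0 -[0 : 'rV_n](scale0r x0) (dhomog_mevalZ _ _ hH) H0 // mulr0.
Qed.

(** Irreducibility of [C]: were [G1 * G2] zero on [C], the prime [f] would divide one of the
    factors. *)
Lemma generic_nonvanishing e1 e2 (G1 G2 : {mpoly K[n]}) x1 x2 :
    G1 \is e1.-homog -> G2 \is e2.-homog ->
    C x1 -> G1.@[x1 0] != 0 -> C x2 -> G2.@[x2 0] != 0 ->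
  exists x, [/\ C x, G1.@[x 0] != 0 & G2.@[x 0] != 0].
Proof.
move=> h1 h2 C1 g1 C2 g2; apply: NNPP => no.
have nd (G : {mpoly K[n]}) x : C x -> G.@[x 0] != 0 -> ~ rdvd f G.
  by move=> /CE[_ fx] /eqP Gx [q e]; apply: Gx; rewrite e mevalM fx mulr0.
have [_ _ fP] := pf; case: (fP G1 G2) => [|/(nd _ _ C1 g1)|/(nd _ _ C2 g2)] //.
apply: (vanishing_form_dvd C1 (dhomogM h1 h2)) => x Cx; rewrite mevalM.
have [->|x1'] := eqVneq G1.@[x 0] 0; first by rewrite mul0r.
have [->|x2'] := eqVneq G2.@[x 0] 0; first by rewrite mulr0.
by case: no; exists x.
Qed.

End PlaneCurve.

Lemma dhomog_dvd_eq0 (K : fieldType) n d e (f H : {mpoly K[n]}) :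
  f != 0 -> f \is d.-homog -> H \is e.-homog -> (e < d)%N -> rdvd f H -> H = 0.
Proof.
move=> f0 hf hH ed [q eH]; apply/eqP; apply: contraT => H0.
have msz (p : {mpoly K[n]}) k : p != 0 -> p \is k.-homog -> msize p = k.+1.
  move=> p0 hp; rewrite -[k](dhomog_uniq p0 (dhomog_msize hp) hp).
  by rewrite prednK // mpolySpred.
have q0 : q != 0 by apply: contra_neq H0 => q0; rewrite eH q0 mul0r.
have := msizeM q0 f0; rewrite -eH (msz _ _ H0 hH) (msz _ _ f0 hf).
by move: (mpolySpred mdeg q0); lia.
Qed.

Theorem proposition1p1 (K : closedFieldType) (C : 'rV[K]_3 -> Prop)
    (d d' d0' : nat) (F1 F2 F01 F02 : {mpoly K[3]}) :
  plane_curve d C ->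
  parameterizable C d' F1 F2 ->
  parameterizable C d0' F01 F02 ->
  (d' < d)%N -> (d0' < d)%N ->
  (d <= d' + d0')%N \/
  (d' = d0' /\
   forall p : {mpoly K[3]}, ideal2 F1 F2 p <-> ideal2 F01 F02 p).
Proof.
move=> [f [[f0 fU irr] hf CE]] parF parF0 _ _.
have [|dlt] := leqP d (d' + d0'); [by left|right].
have pf : prime_elt f := irreducible_prime (@factorial_mpoly K 3) f0 fU irr.
case: parF => hF copF [k [u [hu _ uC [secC secP]]]].
case: parF0 => hF0 copF0 [k0 [u0 [hu0 _ _ [sec0C _]]]].
case: secC => e1 [G1 [hG1 [x1 Cx1 G1x1] sec1]].
case: secP => e2 [G2 [hG2 [t2 _ G2t2] sec2]].
case: sec0C => e3 [G3 [hG3 [x3 Cx3 G3x3] sec3]].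
set F := [tuple F1; F2] in hF copF sec1 sec2.
set F0 := [tuple F01; F02] in hF0 copF0 sec3.
(* [F o u0] inverts [F0 o u] wherever [W] does not vanish. *)
pose W := (G3 \mPo u) * G2.
have hW : W \is (e3 * k + e2).-homog by apply: dhomogM => //;
  apply: dhomog_comp.
have W0 : W != 0.
  rewrite mulf_neq0 //; last by apply: contra_neq G2t2 => ->; rewrite meval0.
  (* At such a point [u(F(x))] is proportional to [x], so [G3 o u] does not vanish at [F(x)]. *)
  have [x [Cx g1 g3]] := generic_nonvanishing pf CE hG1 hG3 Cx1 G1x1 Cx3 G3x3.
  apply: contra_neq g3 => z; have [_ [c c0 ec]] := sec1 x Cx g1.
  have := meval_comp_forms G3 u (eval_forms F x); rewrite z meval0 ec.
  rewrite (dhomog_mevalZ _ _ hG3) => /esym/eqP.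
  by rewrite mulf_eq0 (negPf (expf_neq0 _ c0)) => /eqP.
have hPhi : forms (d0' * k) [tuple tnth F0 i \mPo u | i < 2].
  by move=> i; rewrite tnth_mktuple; apply: dhomog_comp.
have hPsi : forms (d' * k0) [tuple tnth F i \mPo u0 | i < 2].
  by move=> i; rewrite tnth_mktuple; apply: dhomog_comp.
have evPhi t : eval_forms [tuple tnth F0 i \mPo u | i < 2] t =
    eval_forms F0 (eval_forms u t).
  by apply/rowP=> i; rewrite !mxE tnth_mktuple meval_comp_forms.
have evPsi t : eval_forms [tuple tnth F i \mPo u0 | i < 2] t =
    eval_forms F (eval_forms u0 t).
  by apply/rowP=> i; rewrite !mxE tnth_mktuple meval_comp_forms.
case: (retraction_projectivity hPhi hPsi hW W0) => [t t0|a [b [det0 ab]]].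
  rewrite mevalM meval_comp_forms mulf_eq0 negb_or => /andP[g3 g2].
  have [Cu [c c0 ec]] := sec2 t t0 g2.
  have [F0u [c' c'0 ec']] := sec3 _ Cu g3.
  rewrite evPhi evPsi; split=> //; exists (c' ^+ d' * c).
    by rewrite mulf_neq0 ?expf_neq0.
  by rewrite ec' (eval_formsZ _ _ hF) ec scalerA.
pose A := a.1 *: F01 + a.2 *: F02; pose B := b.1 *: F01 + b.2 *: F02.
have hA : A \is d0'.-homog.
  by apply: rpredD; apply: rpredZ; [apply: (hF0 ord0)|apply: (hF0 ord_max)].
have hB : B \is d0'.-homog.
  by apply: rpredD; apply: rpredZ; [apply: (hF0 ord0)|apply: (hF0 ord_max)].
have hF1 : F1 \is d'.-homog := hF ord0.
have hF2 : F2 \is d'.-homog := hF ord_max.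
pose H := A * F1 - B * F2.
have hH : H \is (d0' + d').-homog by apply: rpredB; apply: dhomogM.
have H0 : H = 0.
  apply: (dhomog_dvd_eq0 f0 hf hH); first by rewrite addnC.
  (* [H] is seen to vanish only where [G1] does not, so [f] is shown to divide [H * G1]; it does not
     divide [G1], which is nonzero at [x1]. *)
  have [_ _ /(_ H G1)] := pf; case=> // [|[q eG1]]; last first.
    by case/CE: Cx1 => _ fx1; move: G1x1; rewrite eG1 mevalM fx1 mulr0 eqxx.
  apply: (vanishing_form_dvd pf CE Cx1 (dhomogM hH hG1)) => x Cx;
    rewrite mevalM.
  have [->|g1] := eqVneq G1.@[x 0] 0; first by rewrite mulr0.
  have [_ [c c0 ec]] := sec1 x Cx g1.
  (* The projectivity is read at [t = F(x)], where [u(t) = c x]; the factor [c ^+ d0'] then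
     cancels. *)
  have := ab (eval_forms F x); rewrite evPhi ec (eval_formsZ _ _ hF0).
  rewrite !mxE /H /A /B mevalB !mevalM !mevalD !mevalZ /= => e.
  suff -> : ((a.1 * F01.@[x 0] + a.2 * F02.@[x 0]) * F1.@[x 0] -
    (b.1 * F01.@[x 0] + b.2 * F02.@[x 0]) * F2.@[x 0]) = 0 by rewrite mul0r.
  apply: (mulfI (expf_neq0 d0' c0)); rewrite mulr0; apply/eqP.
  rewrite mulrBr subr_eq0; apply/eqP; move: e.
  rewrite !(mulrCA _ (c ^+ d0')) -!mulrDr -!mulrA.
  by [].
(* Cramer's rule recovers the second pair from [(A, B)], so [(A, B)] inherits its coprimality and
   generates the same ideal. *)
have eF01 : (a.1 * b.2 - a.2 * b.1) *: F01 = b.2 *: A - a.2 *: B.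
  by rewrite /A /B -!mul_mpolyC !(mpolyCB, mpolyCM); ring.
have eF02 : (a.1 * b.2 - a.2 * b.1) *: F02 = a.1 *: B - b.1 *: A.
  by rewrite /A /B -!mul_mpolyC !(mpolyCB, mpolyCM); ring.
have rdvdZ (g p : {mpoly K[3]}) (c : K) : rdvd g p -> rdvd g (c *: p).
  by rewrite -mul_mpolyC; apply: rdvdM.
have copAB (g : {mpoly K[3]}) : rdvd g A -> rdvd g B -> g \is a GRing.unit.
  move=> gA gB; apply: copF0 => i.
  have back p : rdvd g ((a.1 * b.2 - a.2 * b.1) *: p) -> rdvd g p.
    by move/(rdvdZ _ _ (a.1 * b.2 - a.2 * b.1)^-1);
      rewrite scalerA mulVf // scale1r.
  case: i => -[|[|//]] i; apply: back.
    by rewrite (tnth_nth 0) /= eF01; apply: rdvdB; apply: rdvdZ.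
  by rewrite (tnth_nth 0) /= eF02; apply: rdvdB; apply: rdvdZ.
have copF12 (g : {mpoly K[3]}) : rdvd g F2 -> rdvd g F1 -> g \is a GRing.unit.
  by move=> g2 g1; apply: copF => -[[|[|//]] i]; rewrite (tnth_nth 0).
have AFBF : A * F1 = B * F2 by apply/eqP; rewrite -subr_eq0; apply/eqP.
have [c [cU e2' e1']] :=
  coprime_proportional (@factorial_mpoly K 3) copAB copF12 AFBF.
(* Units of a polynomial ring over a field are the nonzero constants. *)
have [r r0 er] : exists2 r : K, r != 0 & c = r%:MP.
  by case/andP: cU => ec rU; exists c@_0%MM; [apply: unit_neq0|apply/eqP].
rewrite {}er {c cU} !mul_mpolyC in e1' e2'.
have Fne : (F1 != 0) || (F2 != 0).
  rewrite -negb_and; apply/negP => /andP[/eqP z1 /eqP z2].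
  have dvd0 : rdvd (0 : {mpoly K[3]}) 0 by exists 0; rewrite mulr0.
  by have := copF12 0; rewrite z1 z2 unitr0 => /(_ dvd0 dvd0).
split.
  (* A nonzero component of [F] is a scalar multiple of [A] or [B], hence homogeneous of both
     degrees. *)
  case/orP: Fne => n0.
    by apply: (dhomog_uniq n0 hF1); rewrite e1'; apply: rpredZ.
  by apply: (dhomog_uniq n0 hF2); rewrite e2'; apply: rpredZ.
have idZ (G1' G2' : {mpoly K[3]}) x y : ideal2 G1' G2' (x *: G1' + y *: G2').
  by exists x%:MP, y%:MP; rewrite !mul_mpolyC.
have ideal_le (P1 P2 Q1 Q2 p : {mpoly K[3]}) :
    ideal2 Q1 Q2 P1 -> ideal2 Q1 Q2 P2 -> ideal2 P1 P2 p -> ideal2 Q1 Q2 p.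
  move=> [s [t ->]] [s' [t' ->]] [v [w ->]].
  by exists (v * s + w * s'), (v * t + w * t'); ring.
have eA : A = r^-1 *: F2 by rewrite e2' scalerA mulVf // scale1r.
have eB : B = r^-1 *: F1 by rewrite e1' scalerA mulVf // scale1r.
move: det0 eF01 eF02; set det := _ - _ => det0 eF01 eF02.
move=> p; split; apply: ideal_le.
- by rewrite e1' /B scalerDr !scalerA; apply: idZ.
- by rewrite e2' /A scalerDr !scalerA; apply: idZ.
- have -> : F01 = (- (det^-1 * a.2 / r)) *: F1 + (det^-1 * b.2 / r) *: F2.
    rewrite -[LHS](scalerK det0) eF01 eA eB.
    by rewrite scalerBr !scalerA addrC scaleNr.
  exact: idZ.
- have -> : F02 = (det^-1 * a.1 / r) *: F1 + (- (det^-1 * b.1 / r)) *: F2.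
    rewrite -[LHS](scalerK det0) eF02 eA eB.
    by rewrite scalerBr !scalerA scaleNr.
  exact: idZ.
Qed.
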